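(* Let $G=(V,E)$ be a graph and suppose that there exists a $1$-dependent $q$-coloring $X=(X_v)_{v\in V}$ of $G$ with the random variables $(X_v)_{v\in V}$ identically distributed. (i) If $G=\mathbb{Z}^d$ (with $d\ge 1$), then $q\geq (d+1)^{d+1}/d^d$; moreover $q\geq 9$ if $d=2$, and $q\geq 12$ if $d=3$. (ii) If $G=T_\Delta$, the infinite $\Delta$-regular tree (with $\Delta\ge 2$), then $q\geq \Delta^\Delta/(\Delta-1)^{\Delta-1}$.
   Context: $\mathbb{Z}^d$ denotes the hypercubic lattice: the graph with vertex set $\mathbb{Z}^d$ and an edge between $u$ and $v$ whenever $\|u-v\|_1=1$. For a graph $G=(V,E)$, a stochastic process $X=(X_v)_{v\in V}$ is a $q$-coloring if each $X_v$ takes values in $\{1,\ldots,q\}$ and almost surely $X_u\neq X_v$ whenever $u$ and $v$ are neighbors. It is $k$-dependent if its restrictions to two subsets of $V$ are independent whenever the subsets are at graph-distance greater than $k$ from each other. *)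

(* Defs.v *)
From HB Require Import structures.
From mathcomp Require Import all_boot all_order all_algebra.
From mathcomp Require Import all_classical all_reals all_analysis.

Set Implicit Arguments.
Unset Strict Implicit.
Unset Printing Implicit Defensive.

Import Order.TTheory GRing.Theory Num.Theory.

Local Open Scope classical_set_scope.
Local Open Scope ring_scope.

Record graph := Graph {
  vertex :> eqType;
  edge : rel vertex;
  edge_sym : symmetric edge;
  edge_irr : irreflexive edge }.

Definition graph_isomorphic (G H : graph) : Prop :=
  exists2 f : G -> H, bijective f & forall u v, edge (f u) (f v) = edge u v.

Definition is_walk (G : graph) (u v : G) (p : seq G) : Prop :=
  path (@edge G) u p /\ last u p = v.

(* The walk given by [p] from its origin has [size p] edges, so this says that
   the graph distance between [A] and [B] is greater than [k]; vertices in
   different components are infinitely far apart. *)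
Definition dist_gt (G : graph) (k : nat) (A B : set G) : Prop :=
  forall u v p, A u -> B v -> is_walk u v p -> (k < size p)%N.

Definition dist1 (d : nat) (u v : 'rV[int]_d) : int :=
  \sum_(i < d) `|u ord0 i - v ord0 i|.

Lemma Zlattice_sym d : symmetric (fun u v : 'rV[int]_d => dist1 u v == 1).
Proof.
by move=> u v; congr (_ == _); apply: eq_bigr => i _; rewrite distrC.
Qed.

Lemma Zlattice_irr d : irreflexive (fun u v : 'rV[int]_d => dist1 u v == 1).
Proof.
by move=> u; rewrite /dist1 big1// => i _; rewrite subrr normr0.
Qed.

Definition Zlattice (d : nat) : graph :=
  Graph (@Zlattice_sym d) (@Zlattice_irr d).

Definition graph_connected (G : graph) : Prop :=
  forall u v : G, exists p, is_walk u v p.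

(* [ucycle] also holds of the sequence [:: u; v] going back and forth along an
   edge, which is not a cycle of the graph. *)
Definition graph_acyclic (G : graph) : Prop :=
  forall c : seq G, ucycle (@edge G) c -> (size c <= 2)%N.

Definition graph_regular (G : graph) (D : nat) : Prop :=
  forall u : G, ([set v | edge u v] #= `I_D)%card.

(* These properties determine the graph up to isomorphism. *)
Definition infinite_regular_tree (D : nat) (G : graph) : Prop :=
  [/\ infinite_set [set: G], graph_connected G, graph_acyclic G
    & graph_regular G D].

Section coloring.
Context {disp : measure_display} {Om : measurableType disp} {R : realType}.
Variables (P : probability Om R) (G : graph) (X : G -> {RV P >-> nat}).

Definition is_coloring (q : nat) : Prop :=
  (forall v w, (1 <= X v w <= q)%N) /\
  (forall u v, edge u v -> \forall w \ae P, X u w != X v w).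

Definition sigma_restr (A : set G) : set (set Om) :=
  <<s \bigcup_(v in A) preimage_set_system [set: Om] (X v) measurable >>.

Definition restr_independent (A B : set G) : Prop :=
  forall E F, sigma_restr A E -> sigma_restr B F ->
    P (E `&` F) = (P E * P F)%E.

Definition k_dependent (k : nat) : Prop :=
  forall A B : set G, dist_gt k A B -> restr_independent A B.

Definition identically_distributed : Prop :=
  forall u v (C : set nat), distribution P (X u) C = distribution P (X v) C.

End coloring.

(* Main.v *)
Require Import Defs.
From mathcomp Require Import all_boot all_order all_algebra.
From mathcomp Require Import all_classical all_reals all_analysis.
From mathcomp Require Import ring lra zify.

Set Implicit Arguments.
Unset Strict Implicit.
Unset Printing Implicit Defensive.

Import Order.TTheory GRing.Theory Num.Theory.
Local Open Scope ring_scope.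

(** Fix a color a of probability p at least 1/q, and let N(S) be the
    probability that no vertex of the finite set S receives the color a. Two
    neighbors never both receive a, and 1-dependence makes the color of v
    independent of the colors outside its neighborhood, so for v outside S

      N(S + v) = N(S) - p N(S minus the neighbors of v).

    Hence N depends on p and the graph alone (it is the independence
    polynomial at -p), and the theorem follows from N being nonnegative on
    every finite set: the inequalities below, which come from Shearer's
    analysis of the local lemma, cannot hold when p is too large.

    Only this recursion is kept from the probability space ([hard_core],
    obtained in [hard_core_color]). First N > 0 everywhere
    ([hard_core_gt0]), so one can form the ratio N(S + v) / N(S), the
    conditional probability that v avoids a given that S does. It decreases
    as S grows ([ratio_anti]). Let rho (v, A) be its infimum over finite
    subsets S of a possibly infinite region A. Peeling off neighbors
    w_1, ..., w_k of v from A one at a time gives ([rho_step])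

      p <= (1 - rho (v, A)) rho (w_1, C_1) ... rho (w_k, C_k)

    whenever C_i is contained in A with w_1, ..., w_i removed. Taking suprema
    of rho over a family of regions, such as all translates of one region,
    turns this into a closed system of inequalities between finitely many
    numbers of [0, 1].

    General bound. Suppose that each vertex has d neighbors of rank one less:
    in the lattice the rank is the sum of the coordinates, in the tree of
    degree d + 1 it is minus the distance to a root. With the region of
    vertices of smaller rank the system is p <= (1 - x) x^d, and the maximum
    of the right-hand side is d^d / (d+1)^(d+1).

    Dimensions 2 and 3. Seeing the lattice as a product of a line with a
    lattice of one dimension less, use as regions everything of lower rank
    together with half (a) or all (b) of the row of v. With m = d - 1,

      p <= (1 - a) a b^m   and   p <= (1 - b) a^2 b^m.

    For m = 2 this contradicts p >= 1/11. For m = 1, adding both inequalities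
    gives 2 p <= k (1 - k) <= 1/4 with k = a b, hence p <= 1/8, with equality
    only for a = 3/4 and b = 2/3; three more regions, which keep part of the
    row above v, exclude this last case. *)

(** * Hard-core avoidance functionals *)

(** Finite sets of vertices are represented by sequences; [hc_anti] makes the
    order and the repetitions irrelevant. *)
Record hard_core (R : realType) (V : eqType) (e : rel V) (p : R)
    (N : seq V -> R) : Prop := HardCore {
  hc_nil : N [::] = 1;
  hc_anti : forall s t, {subset s <= t} -> N t <= N s;
  hc_ge0 : forall s, 0 <= N s;
  hc_cons : forall v s, v \notin s ->
    N (v :: s) = N s - p * N [seq u <- s | ~~ e v u] }.

Lemma hard_core_pullback (R : realType) (V W : eqType) (e : rel V)
    (e' : rel W) (p : R) (N : seq V -> R) (g : W -> V) :
  injective g -> (forall u v, e (g u) (g v) = e' u v) ->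
  hard_core e p N -> hard_core e' p (N \o map g).
Proof.
move=> gi ge [N0 Na N_ge0 Nc]; split => //=.
- move=> s t st; apply: Na => _ /mapP[u us ->].
  by apply: map_f; exact: st.
- move=> v s vs; rewrite Nc ?mem_map// filter_map.
  by congr (_ - _ * N (map g _)); apply: eq_filter => u /=; rewrite ge.
Qed.

Lemma exists_min_rank (V : eqType) (rk : V -> int) (s : seq V) :
  s != [::] -> exists2 v, v \in s & forall u, u \in s -> rk v <= rk u.
Proof.
elim: s => // x s IH _; have [->|/IH[v vs vmin]] := eqVneq s [::].
  by exists x; rewrite ?mem_head// => u; rewrite inE => /eqP->.
have [xv|vx] := leP (rk x) (rk v).
  exists x; rewrite ?mem_head// => u; rewrite inE => /orP[/eqP->//|/vmin].
  exact: le_trans.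
exists v; rewrite ?inE ?vs ?orbT// => u; rewrite inE => /orP[/eqP->|/vmin//].
exact: ltW.
Qed.

(** If u is outside s then N (u :: s) >= 0 bounds N s below by p times the
    value of N on s without the neighbors of u. Taking u below an element of s
    of minimal rank makes that set smaller, so induction applies. *)
Lemma hard_core_gt0 (R : realType) (V : eqType) (e : rel V) (p : R)
    (N : seq V -> R) (rk : V -> int) :
  symmetric e -> hard_core e p N -> 0 < p ->
  (forall v, exists2 w, e v w & rk w < rk v) ->
  forall s, 0 < N s.
Proof.
move=> es [N0 Na N_ge0 Nc] p0 down s.
have [n] := ubnP (size s); elim: n s => // n IH s sn.
have [->|/(exists_min_rank rk)[v vs vmin]] := eqVneq s [::].
  by rewrite N0.
have [w vw wv] := down v.
have ws : w \notin s by apply: contraTN wv => /vmin; rewrite leNgt.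
have := N_ge0 (w :: s); rewrite Nc// subr_ge0; apply: lt_le_trans.
rewrite mulr_gt0// IH//.
suff: (size [seq u <- s | ~~ e w u] < size s)%N by move: sn; lia.
rewrite size_filter.
rewrite -(count_predC (e w) s) -[ltnLHS]add0n ltn_add2r -has_count.
by apply/hasP; exists v; rewrite // es.
Qed.

(** * Ratios and their infima over regions *)

Section Ratios.
Variables (R : realType) (V : eqType) (e : rel V) (p : R) (N : seq V -> R).
Hypotheses (hN : hard_core e p N) (p_gt0 : 0 < p).
Hypothesis N_gt0 : forall s, 0 < N s.

Local Notation avoid v s := [seq u <- s | ~~ e v u].

Lemma eq_mem_N s t : s =i t -> N s = N t.
Proof.
by move=> st; apply/le_anti/andP; split; apply: (hc_anti hN) => u;
  rewrite st.
Qed.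

Definition ratio s v := N (v :: s) / N s.

Lemma ratioE s v : v \notin s -> ratio s v = 1 - p * (N (avoid v s) / N s).
Proof.
move=> vs; rewrite /ratio (hc_cons hN)// mulrBl divff ?gt_eqF//.
by rewrite mulrA.
Qed.

Lemma ratio_ge0 s v : 0 <= ratio s v.
Proof. by rewrite divr_ge0// ltW. Qed.

Lemma ratio_le1 s v : ratio s v <= 1.
Proof.
rewrite ler_pdivrMr// mul1r; apply: (hc_anti hN) => u us.
by rewrite inE us orbT.
Qed.

(** If v and w are adjacent, w disappears from the numerator of the recursion
    for v while the denominator N (w :: s) is at most N s. Otherwise the claim
    is the same monotonicity for the vertex w, between the smaller sets
    [avoid v s] and s. *)
Lemma ratio_cons s v w : v \notin s -> w \notin s -> v != w ->
  ratio s w <= ratio (avoid v s) w ->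
  ratio (w :: s) v <= ratio s v.
Proof.
move=> vs ws vw IH.
have vws : v \notin w :: s by rewrite inE negb_or vw.
rewrite !ratioE// lerD2l lerN2 ler_pM2l// ler_pdivrMr// mulrAC.
rewrite ler_pdivlMr//=; case: ifP => [_|/negbFE evw].
  move: IH; rewrite ler_pdivrMr// mulrAC ler_pdivlMr//.
  by rewrite mulrC [X in _ <= X]mulrC.
rewrite ler_pM2l//; apply: (hc_anti hN) => u us.
by rewrite inE us orbT.
Qed.

(** The sets are enlarged one vertex at a time. One such step on a set t'
    appeals, through [ratio_cons], to the result for subsets of t', whence the
    outer induction on the size of the larger set and the inner one on the
    number of vertices still to be added. *)
Lemma ratio_anti s t v : {subset s <= t} -> v \notin t ->
  ratio t v <= ratio s v.
Proof.
have uniq_case n (s' t' : seq V) u : (size t' < n)%N -> uniq t' ->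
    {subset s' <= t'} -> u \notin t' -> ratio t' u <= ratio s' u.
  elim: n s' t' u => // n IHn s' t' u.
  have [k] := ubnP (count [predC s'] t').
  elim: k t' => // k IHk t' kt tn ut st vt.
  have [ts|] := boolP (all [in s'] t').
    rewrite /ratio (eq_mem_N (s := t') (t := s')) ?(eq_mem_N (s := u :: t') (t := u :: s'))//.
      by move=> z; rewrite !inE; congr orb; apply/idP/idP => [/(allP ts)|/st].
    by move=> z; apply/idP/idP => [/(allP ts)|/st].
  rewrite -has_predC => /hasP[w wt /= ws].
  have tE : t' =i w :: rem w t' by move=> z; rewrite (perm_mem (perm_to_rem wt)).
  have urem : uniq (rem w t') by rewrite rem_uniq.
  have wrem : w \notin rem w t' by rewrite mem_rem_uniq// !inE eqxx.
  have urem' : u \notin rem w t' by apply: contra vt => /mem_rem.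
  have size_rem' : (size (rem w t') < n)%N.
    by rewrite size_rem//; have: (0 < size t')%N by [case: (t') wt]; lia.
  have -> : ratio t' u = ratio (w :: rem w t') u.
    by congr (_ / _); apply: eq_mem_N => z; rewrite ?tE// !(in_cons u) tE.
  have uw : u != w by apply: contraNneq vt => ->.
  apply: (@le_trans _ _ (ratio (rem w t') u)).
    apply: ratio_cons => //; apply: IHn => //.
    by move=> z; rewrite mem_filter => /andP[].
  apply: IHk => //.
  - rewrite -ltnS (leq_trans _ kt)// ltnS.
    by have /permP -> := perm_to_rem wt; rewrite /= ws.
  - by apply: leq_trans (size_rem' ) _.
  - move=> z zs; have := st _ zs; rewrite tE inE => /orP[/eqP zw|//].
    by move: ws; rewrite -zw zs.
move=> st vt.
have -> : ratio t v = ratio (undup t) v.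
  by congr (_ / _); apply: eq_mem_N => z; rewrite ?(in_cons v) mem_undup.
apply: (uniq_case (size (undup t)).+1) => //; rewrite ?undup_uniq ?mem_undup//.
by move=> z /st; rewrite mem_undup.
Qed.

(** A region c is a pointed set: [c.1] is the vertex that is exposed, [c.2]
    the set from which the conditioning is taken. *)
Definition rho (c : V * set V) : R :=
  inf [set ratio s c.1 | s in [set s : seq V | forall u, u \in s -> c.2 u]].

Lemma has_inf_ratio (c : V * set V) :
  has_inf [set ratio s c.1 | s in [set s : seq V | forall u, u \in s -> c.2 u]].
Proof.
split; first by exists (ratio [::] c.1), [::].
by exists 0 => _ [s _ <-]; exact: ratio_ge0.
Qed.

Lemma rho_le_ratio c s : (forall u, u \in s -> c.2 u) -> rho c <= ratio s c.1.
Proof.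
by move=> sc; apply: ge_inf; [case: (has_inf_ratio c)|exists s].
Qed.

Lemma rho_ge0 c : 0 <= rho c.
Proof.
apply: lb_le_inf; first by case: (has_inf_ratio c).
by move=> _ [s _ <-]; exact: ratio_ge0.
Qed.

Lemma rho_le1 c : rho c <= 1.
Proof. by apply: le_trans (ratio_le1 [::] c.1); exact: rho_le_ratio. Qed.

Lemma rho_lt_ratio c x : rho c < x ->
  exists2 s : seq V, (forall u, u \in s -> c.2 u) & ratio s c.1 < x.
Proof. by move=> /(inf_lt (has_inf_ratio c).1)[_ [s sc <-] sx]; exists s. Qed.

Lemma rho_anti v (C D : set V) : (C `<=` D)%classic -> rho (v, D) <= rho (v, C).
Proof.
move=> CD; apply: lb_le_inf; first by case: (has_inf_ratio (v, C)).
by move=> _ [s sC <-]; apply: (@rho_le_ratio (v, D)) => u /sC /CD.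
Qed.

(** The apexes are to be deleted from A one by one; while an apex is exposed,
    the whole of its region must still be there although the earlier apexes
    are gone. *)
Fixpoint nested (A : set V) (cs : seq (V * set V)) : Prop :=
  if cs is c :: cs' then
    [/\ A c.1, (c.2 `<=` A)%classic, ~ c.2 c.1 & nested (A `\ c.1)%classic cs']
  else True.

(** Telescoping: the ratio of N on t to N on t without the apexes is a product
    of ratios at the successive apexes, and each of them is close to its [rho]
    as soon as t contains suitable finite subsets of the regions. *)
Lemma peel_nested (A : set V) cs y : nested A cs -> \prod_(c <- cs) rho c < y ->
  exists2 s : seq V, (forall u, u \in s -> A u) &
    forall t : seq V, {subset s <= t} -> (forall u, u \in t -> A u) ->
      N t <= y * N [seq u <- t | u \notin map fst cs].
Proof.
elim: cs A y => [|[w C] cs IH] A y /=.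
  rewrite big_nil => _ y1; exists [::] => // t _ _.
  have -> : [seq u <- t | u \notin [::]] = t by apply/all_filterP/allP.
  by rewrite ler_peMl// ltW.
move=> [Aw CA Cw nest]; rewrite big_cons => ry.
have [x1 [x2 [rx1 rx2 x12]]] : exists x1 x2,
    [/\ rho (w, C) < x1, \prod_(c <- cs) rho c < x2 & x1 * x2 <= y].
  set a := rho (w, C) in ry *; set b := \prod_(c <- cs) rho c in ry *.
  have a0 : 0 <= a by exact: rho_ge0.
  have a1 : a <= 1 by exact: rho_le1.
  have b0 : 0 <= b by apply: prodr_ge0 => c _; exact: rho_ge0.
  have b1 : b <= 1.
    by apply: prodr_ile1 => c _; rewrite rho_ge0 rho_le1.
  (* (a + d) (b + d) = a b + d (a + b + d), and a + b + d <= 3. *)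
  pose d := Num.min 1 ((y - a * b) / 3).
  have d0 : 0 < d by rewrite lt_min ltr01/= divr_gt0// subr_gt0.
  have d1 : d <= 1 by rewrite ge_min lexx.
  have d3 : d <= (y - a * b) / 3 by rewrite ge_min lexx orbT.
  exists (a + d), (b + d); split; [lra|lra|].
  have : d * (a + b + d) <= d * 3 by rewrite ler_wpM2l//; lra.
  by move=> ?; nra.
have [s1 s1C s1x] := rho_lt_ratio rx1.
have [s2 s2A s2x] := IH _ _ nest rx2.
exists (w :: s1 ++ s2) => [u|t st tA].
  by rewrite inE mem_cat => /orP[/eqP->//|/orP[/s1C /CA//|/s2A[]]].
pose t' := [seq u <- t | u != w].
have tE : t =i w :: t'.
  move=> u; rewrite inE mem_filter; have [->|//] := eqVneq u w.
  by rewrite st ?mem_head.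
have wt' : w \notin t' by rewrite mem_filter eqxx.
have s1t' : {subset s1 <= t'}.
  move=> u us; rewrite mem_filter st ?inE ?mem_cat ?us ?orbT// andbT.
  by apply: contra_notN Cw => /eqP <-; exact: s1C.
have s2t' : {subset s2 <= t'}.
  move=> u us; rewrite mem_filter st ?inE ?mem_cat ?us ?orbT// andbT.
  by have [_ /eqP] := s2A _ us.
have t'A u : u \in t' -> (A `\ w)%classic u.
  by rewrite mem_filter => /andP[/eqP uw /tA].
have x1_ge0 : 0 <= x1 by rewrite (le_trans (rho_ge0 (w, C)))// ltW.
have : ratio t' w <= x1.
  by apply: le_trans (ltW s1x); exact: ratio_anti.
rewrite ler_pdivrMr// -(eq_mem_N tE) => /le_trans; apply.
apply: le_trans (ler_wpM2l x1_ge0 (s2x _ s2t' t'A)) _.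
rewrite mulrA.
rewrite (_ : [seq u <- t' | _] = [seq u <- t | u \notin w :: map fst cs]).
  by rewrite ler_wpM2r// ltW.
by rewrite -filter_predI; apply: eq_filter => u /=; rewrite inE negb_or andbC.
Qed.

(** With s as in [peel_nested], the recursion at v reads
    (1 - ratio) N s = p N (avoid v s), and N (avoid v s) is at least N on s
    without the apexes because these are neighbors of v. The product form,
    without divisions, avoids any discussion of whether [rho] vanishes. *)
Lemma rho_step (v : V) (A : set V) cs : ~ A v -> nested A cs ->
  (forall c, c \in map fst cs -> e v c) ->
  p <= (1 - rho (v, A)) * \prod_(c <- cs) rho c.
Proof.
move=> Av nest adj; apply/ler_addgt0Pr => d d0.
set y := \prod_(c <- cs) rho c; have yd : y < y + d by rewrite ltrDl.
have [s sA sP] := peel_nested nest yd.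
have {sP} NsP := sP s (fun _ => id) sA.
have vs : v \notin s by apply: contra_notN Av; exact: sA.
set T := [seq u <- s | _] in NsP.
have NT : N T <= N (avoid v s).
  apply: (hc_anti hN) => u; rewrite !mem_filter => /andP[vu ->].
  by rewrite andbT; apply: contra vu => /adj.
have rv := @rho_le_ratio (v, A) s sA; rewrite /= in rv.
have r1 := rho_le1 (v, A).
have : p * N T <= (1 - rho (v, A)) * ((y + d) * N T).
  apply: (@le_trans _ _ ((1 - ratio s v) * N s)).
    rewrite ratioE// opprB addrC subrK mulrA divfK ?gt_eqF//.
    by rewrite ler_pM2l.
  by apply: ler_pM; rewrite ?subr_ge0 ?ratio_le1 ?lerD2l ?lerN2// ltW.
rewrite mulrA ler_pM2r// => /le_trans; apply.
by rewrite mulrDr lerD2l ler_piMl ?(ltW d0)// gerBl rho_ge0.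
Qed.

(** The supremum over a family of regions makes [rho_step] uniform in the
    family without requiring the graph to have symmetries. *)
Definition worst (I : Type) (F : I -> V * set V) : R := sup (range (rho \o F)).

Lemma rho_le_worst (I : Type) (F : I -> V * set V) i : rho (F i) <= worst F.
Proof.
apply: ub_le_sup; last by exists i.
by exists 1 => _ [j _ <-]; exact: rho_le1.
Qed.

Lemma worst_ge0 (I : Type) (F : I -> V * set V) : I -> 0 <= worst F.
Proof. by move=> i; apply: le_trans (rho_le_worst F i); exact: rho_ge0. Qed.

Lemma worst_le1 (I : Type) (F : I -> V * set V) : I -> worst F <= 1.
Proof.
move=> i; apply: ge_sup; first by exists (rho (F i)), i.
by move=> _ [j _ <-]; exact: rho_le1.
Qed.

Lemma worst_step (I : Type) (F : I -> V * set V) (M : R) : I ->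
  (forall i, ~ (F i).2 (F i).1) ->
  (forall i, exists cs, [/\ nested (F i).2 cs,
     forall w, w \in map fst cs -> e (F i).1 w
     & \prod_(c <- cs) rho c <= M]) ->
  p <= (1 - worst F) * M.
Proof.
move=> i0 Fi nest.
have rhoM i : p <= (1 - rho (F i)) * M.
  have [cs [ncs acs csM]] := nest i.
  apply: (@le_trans _ _ ((1 - rho (F i)) * \prod_(c <- cs) rho c)).
    have -> : F i = ((F i).1, (F i).2) by case: (F i).
    by apply: rho_step.
  by rewrite ler_wpM2l// subr_ge0 rho_le1.
have M0 : 0 < M.
  have := lt_le_trans p_gt0 (rhoM i0); apply: contraTT; rewrite -!leNgt => M0.
  by rewrite mulr_ge0_le0// subr_ge0 rho_le1.
rewrite -ler_pdivrMr// lerBrDr -lerBrDl.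
apply: ge_sup; first by exists (rho (F i0)), i0.
move=> _ [i _ <-] /=.
by rewrite lerBrDl -lerBrDr ler_pdivrMr.
Qed.

(** * The bound for ranked graphs *)

Definition lower (rk : V -> int) (v : V) : V * set V :=
  (v, [set u | rk u < rk v]%classic).

(** Vertices of equal rank belong to none of each other's lower sets, so they
    can be deleted in any order. *)
Lemma nested_lower (rk : V -> int) r (A : set V) (ws : seq V) : uniq ws ->
  (forall w, w \in ws -> A w /\ rk w = r) ->
  (forall u, rk u < r -> A u) -> nested A (map (lower rk) ws).
Proof.
elim: ws A => //= w ws IH A /andP[wws uws] wsA rA.
have [Aw rkw] := wsA _ (mem_head _ _).
split => //.
- by move=> u /=; rewrite rkw; exact: rA.
- by rewrite ltxx.
apply: IH => // [u uws'|u ur].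
  have [Au rku] := wsA u (mem_behead (s := w :: ws) uws'); split=> //.
  by split=> // uw; move: wws; rewrite -uw uws'.
by split; [exact: rA|move=> uw; move: ur; rewrite uw rkw ltxx].
Qed.

Lemma ranked_fixpoint (rk : V -> int) (d : nat) (v0 : V) :
  (forall v, exists ws, [/\ size ws = d, uniq ws
    & forall w, w \in ws -> e v w /\ rk w = rk v - 1]) ->
  exists2 x, 0 <= x <= 1 & p <= (1 - x) * x ^+ d.
Proof.
move=> below; pose x := worst (lower rk).
have x0 : 0 <= x by exact: worst_ge0.
exists x; first by rewrite x0 worst_le1.
apply: worst_step => // v /=; first by rewrite ltxx.
have [ws [<- uws wsP]] := below v; exists (map (lower rk) ws); split.
- apply: (@nested_lower rk (rk v - 1)) => // [w /wsP[_ rkw]|u ur].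
    by split=> //=; rewrite rkw; lia.
  by rewrite /=; lia.
- by move=> w; rewrite -map_comp map_id => /wsP[].
- have -> : x ^+ size ws = \prod_(w <- ws) x.
    by rewrite big_const_seq count_predT -Monoid.iteropE.
  rewrite big_map; apply: ler_prod => w _.
  by rewrite rho_ge0/=; exact: rho_le_worst.
Qed.

End Ratios.

(** Arithmetic-geometric mean inequality for d (1 - x) and d copies of x, whose
    sum is d. *)
Lemma fixpoint_le (R : realFieldType) (d : nat) (x : R) : (0 < d)%N ->
  0 <= x <= 1 -> (1 - x) * x ^+ d <= d%:R ^+ d / (d + 1)%:R ^+ (d + 1).
Proof.
move=> d0 /andP[x0 x1].
have dR : 0 < d%:R :> R by rewrite ltr0n.
have d1R : 0 < (d + 1)%:R :> R by rewrite ltr0n addn1.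
pose E (i : 'I_d.+1) := if i == ord0 then d%:R * (1 - x) else x.
have E0 : {in predT, forall i, 0 <= E i}.
  by move=> i _; rewrite /E; case: ifP => // _; rewrite mulr_ge0 ?subr_ge0// ltW.
have prodE : \prod_i E i = d%:R * (1 - x) * x ^+ d.
  rewrite big_ord_recl /E eqxx; congr (_ * _).
  by rewrite (eq_bigr (fun=> x))// prodr_const card_ord.
have sumE : \sum_i E i = d%:R.
  rewrite big_ord_recl /E eqxx (eq_bigr (fun=> x))// sumr_const card_ord.
  by rewrite -mulr_natl; ring.
have := (leif_AGM E0).1; rewrite prodE sumE card_ord -addn1.
rewrite -mulrA expr_div_n exprD expr1 (mulrC (d%:R ^+ d)) -mulrA.
by rewrite ler_pM2l.
Qed.

Lemma ranked_density (R : realType) (V : eqType) (e : rel V) (p : R)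
    (N : seq V -> R) (rk : V -> int) (d : nat) (v0 : V) :
  symmetric e -> hard_core e p N -> 0 < p -> (0 < d)%N ->
  (forall v, exists ws, [/\ size ws = d, uniq ws
    & forall w, w \in ws -> e v w /\ rk w = rk v - 1]) ->
  p <= d%:R ^+ d / (d + 1)%:R ^+ (d + 1).
Proof.
move=> es hN p0 d0 below.
have N0 : forall s, 0 < N s.
  apply: (hard_core_gt0 (rk := rk) es hN p0) => v.
  have [[|w ws] [sz _ wsP]] := below v; first by move: d0; rewrite -sz.
  by have [vw rkw] := wsP w (mem_head _ _); exists w => //; rewrite rkw; lia.
have [x x01 /le_trans] := ranked_fixpoint hN p0 N0 v0 below; apply.
exact: fixpoint_le.
Qed.

(** * Regular trees *)

Lemma infinite_set_nonempty (T : Type) (A : set T) :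
  infinite_set A -> (A !=set0)%classic.
Proof.
move=> inf; apply/set0P; apply: contra_notN inf => /eqP ->; exact: finite_set0.
Qed.

Lemma card_eq_seq (T : eqType) (A : set T) (n : nat) : (A #= `I_n)%card ->
  exists s : seq T, [/\ size s = n, uniq s & forall x, x \in s <-> A x].
Proof.
elim: n A => [|n IH] A.
  by rewrite II0 card_eq0 => /eqP->; exists [::].
move=> /eq_cardSP[x Ax /IH[s [<- us sP]]]; exists (x :: s); split => //=.
  rewrite us andbT; apply/negP => /sP[_]; exact.
move=> y; rewrite inE; split => [/orP[/eqP->//|/sP[]//]|Ay].
by have [//|yx] := eqVneq y x; apply/sP; split=> //; exact/eqP.
Qed.

Section Depth.
Variables (G : graph) (o : G).
Hypothesis conn : graph_connected G.

Let walk_size (u : G) : exists n,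
  `[< exists2 s, is_walk u o s & size s = n >].
Proof. by have [s us] := conn u o; exists (size s); apply/asboolP; exists s. Qed.

Definition depth (u : G) : nat := ex_minn (walk_size u).

Lemma depth_walk u : exists2 s, is_walk u o s & size s = depth u.
Proof. by rewrite /depth; case: ex_minnP => n /asboolP. Qed.

Lemma depth_le u s : is_walk u o s -> (depth u <= size s)%N.
Proof.
move=> us; rewrite /depth; case: ex_minnP => n _; apply.
by apply/asboolP; exists s.
Qed.

Lemma depth_edge u v : edge u v -> (depth u <= (depth v).+1)%N.
Proof.
move=> uv; have [s [vs so] <-] := depth_walk v.
by apply: (@depth_le u (v :: s)); split; rewrite /= ?uv.
Qed.

(** The depth decreases strictly along a shortest walk to the root. *)
Lemma geodesic_avoid u v s : u != v -> (depth u <= depth v)%N ->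
  is_walk u o s -> size s = depth u -> v \notin u :: s.
Proof.
move=> uv duv [us so] sz; rewrite inE negb_or eq_sym uv /=.
apply/negP => vs; case/splitPr: vs us so sz => s1 s2.
rewrite cat_path last_cat /= => /and3P[_ _ vs2] s2o sz.
have := @depth_le v s2 (conj vs2 s2o).
by move: sz; rewrite size_cat /=; lia.
Qed.

(** Shortest walks to the root from two such neighbors avoid v; joined at the
    root they would close up through v to a cycle. *)
Lemma shallow_neighbor_unique v u1 u2 : graph_acyclic G ->
  edge v u1 -> edge v u2 -> (depth u1 <= depth v)%N -> (depth u2 <= depth v)%N ->
  u1 = u2.
Proof.
move=> acyc vu1 vu2 d1 d2; apply/eqP; apply: contraT => u12.
have neqv u : edge v u -> u != v.
  by apply: contraTneq => ->; rewrite edge_irr.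
have [s1 w1 sz1] := depth_walk u1; have [s2 w2 sz2] := depth_walk u2.
have v1 := geodesic_avoid (neqv _ vu1) d1 w1 sz1.
have v2 := geodesic_avoid (neqv _ vu2) d2 w2 sz2.
case: w1 w2 => [p1 l1] [p2 l2].
have pr : path (@edge G) o (rev (belast u2 s2)).
  rewrite -l2 rev_path; under eq_path => x y do rewrite edge_sym.
  by [].
have lr : last o (rev (belast u2 s2)) = u2.
  by case: (s2) l2 => [//|y s2'] _; rewrite /= rev_cons last_rcons.
pose s := s1 ++ rev (belast u2 s2).
have ps : path (@edge G) u1 s by rewrite cat_path p1 l1.
have ls : last u1 s = u2 by rewrite last_cat l1.
have vs : v \notin u1 :: s.
  rewrite -cat_cons mem_cat negb_or v1 mem_rev.
  by apply: contra v2 => /mem_belast.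
case: (shortenP ps) ls => t pt ut ts lt.
have /acyc : ucycle (@edge G) (v :: u1 :: t).
  apply/andP; split=> /=.
    by rewrite vu1 rcons_path pt lt edge_sym.
  rewrite -/(uniq (u1 :: t)) ut andbT; apply: contra vs.
  by rewrite !inE => /orP[->//|/ts->]; rewrite orbT.
by case: t lt {pt ut ts} => //= u12'; move: u12; rewrite u12' eqxx.
Qed.

End Depth.

(** Keeping only the neighbors deeper than v loses at most one of them, by
    [shallow_neighbor_unique]. *)
Lemma tree_children (G : graph) (D : nat) (o : G) (conn : graph_connected G) :
  graph_acyclic G -> graph_regular G D -> forall v : G, exists ws : seq G,
    [/\ size ws = D.-1, uniq ws & forall w, w \in ws ->
      edge v w /\ depth o conn w = (depth o conn v).+1].
Proof.
move=> acyc reg v; have [ns [szn un nsP]] := card_eq_seq (reg v).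
pose deep w := (depth o conn v < depth o conn w)%N.
have few : (size (seq.filter (predC deep) ns) <= 1)%N.
  have : uniq (seq.filter (predC deep) ns) by rewrite filter_uniq.
  have : {in seq.filter (predC deep) ns, forall w, edge v w /\ ~~ deep w}.
    by move=> w; rewrite mem_filter => /andP[wd /nsP].
  case: (seq.filter _ _) => [//|x [//|y t]] H /= /andP[xt _].
  have [vx dx] := H x (mem_head _ _).
  have [vy dy] : edge v y /\ ~~ deep y by apply: H; rewrite !inE eqxx orbT.
  rewrite -leqNgt in dx; rewrite -leqNgt in dy.
  have xy := shallow_neighbor_unique acyc vx vy dx dy.
  by move: xt; rewrite xy mem_head.
exists (take D.-1 (seq.filter deep ns)); split.
- rewrite size_takel//.
  have := count_predC deep ns; rewrite -!size_filter szn; move: few; lia.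
- by rewrite take_uniq// filter_uniq.
move=> w /mem_take; rewrite mem_filter => /andP[wd /nsP vw].
split=> //; apply/eqP; rewrite eqn_leq [X in _ && X]wd andbT.
by apply: depth_edge; rewrite edge_sym.
Qed.

Lemma tree_density (R : realType) (G : graph) (D : nat) (p : R)
    (N : seq G -> R) : (2 <= D)%N -> infinite_regular_tree D G -> 0 < p ->
  hard_core (@edge G) p N ->
  p <= (D - 1)%:R ^+ (D - 1) / D%:R ^+ D.
Proof.
move=> D2 [inf conn acyc reg] p0 hN.
have [x0 _] := infinite_set_nonempty inf.
have DE : D = (D - 1 + 1)%N by lia.
rewrite [in X in _ / X]DE.
apply: (ranked_density (rk := fun v => - (depth x0 conn v)%:Z) x0
  (@edge_sym G) hN p0); first by lia.
move=> v; have [ws [sz uws wsP]] := tree_children x0 conn acyc reg v.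
exists ws; split => //; first by rewrite sz; lia.
by move=> w /wsP[vw ->]; split => //; lia.
Qed.

(** * Products of a line with a ranked graph *)

Section Cylinder.
Variables (R : realType) (W : eqType) (e : rel (int * W)) (p : R).
Variables (N : seq (int * W) -> R) (rk : W -> int) (m : nat) (v0 : int * W).
Hypotheses (es : symmetric e) (hN : hard_core e p N) (p_gt0 : 0 < p).
Hypothesis N_gt0 : forall s, 0 < N s.
Hypothesis eP : forall x h, e (x, h) (x - 1, h).
Hypothesis below : forall x h, exists hs, [/\ size hs = m, uniq hs
  & forall k, k \in hs -> e (x, h) (x, k) /\ rk k = rk h - 1].

Local Notation V := (int * W)%type.

Definition sg (s : bool) : int := if s then 1 else -1.

(** The boolean chooses the side of v on which the row is kept, so that the
    supremum over the family covers both mirror images. *)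
Definition half_row (i : V * bool) : V * set V :=
  (i.1, [set u : V | rk u.2 < rk i.1.2 \/
     (u.2 = i.1.2 /\ sg i.2 * (u.1 - i.1.1) < 0)]%classic).

Definition full_row (v : V) : V * set V :=
  (v, [set u : V | rk u.2 < rk v.2 \/ (u.2 = v.2 /\ u.1 != v.1)]%classic).

(** Distinct vertices of equal rank lie on different rows, and neither row
    contains the other apex. *)
Lemma nested_full_row (x : int) (hs : seq W) (r : int) (A : set V) :
  uniq hs -> (forall h, h \in hs -> rk h = r /\ forall y, A (y, h)) ->
  (forall u, rk u.2 < r -> A u) ->
  nested A [seq full_row (x, h) | h <- hs].
Proof.
elim: hs A => //= h hs IH A /andP[hhs uhs] hA rA.
have [rh Ah] := hA _ (mem_head _ _); split => //.
- by move=> [y k] /= [|[-> _]//]; rewrite rh; exact: (rA (y, k)).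
- by rewrite ltxx eqxx; case=> // -[].
apply: IH => // [k khs|u ur].
  have [rk_k Ak] := hA k (mem_behead (s := h :: hs) khs); split => // y.
  by split=> // -[_ kh]; move: hhs; rewrite -kh khs.
by split; [exact: rA|move=> uE; move: ur; rewrite uE rh ltxx].
Qed.

Lemma edge_side s x h : e (x, h) (x - sg s, h).
Proof.
case: s => /=; first exact: eP.
by rewrite opprK es -{2}(addrK 1 x); exact: eP.
Qed.

Lemma prod_full_row x (hs : seq W) :
  \prod_(c <- [seq full_row (x, h) | h <- hs]) rho N c
    <= worst N full_row ^+ size hs.
Proof.
have -> : worst N full_row ^+ size hs = \prod_(h <- hs) worst N full_row.
  by rewrite big_const_seq count_predT -Monoid.iteropE.
rewrite big_map; apply: ler_prod => h _.
by rewrite (rho_ge0 N_gt0)/=; exact: (rho_le_worst hN).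
Qed.

(** Delete the neighbor of v on the row first: what remains contains its half
    row, and then the full rows of the neighbors of lower rank. *)
Lemma half_row_step : p <= (1 - worst N half_row) *
  (worst N half_row * worst N full_row ^+ m).
Proof.
apply: (worst_step hN p_gt0 N_gt0 (v0, true)) => [[[x h] s] /=|[[x h] s]].
  by rewrite ltxx subrr mulr0 ltxx; case=> // -[].
have [hs [<- uhs hsP]] := below x h.
exists (half_row ((x - sg s, h), s) :: [seq full_row (x, k) | k <- hs]).
split=> [/=|w /=|].
- split.
  + by right; split => //; case: s => /=; lia.
  + move=> [y k] /= [kr|[-> yx]]; [by left|right; split=> //].
    by case: s yx => /=; lia.
  + by rewrite ltxx subrr mulr0 ltxx; case=> // -[].
  apply: (@nested_full_row _ _ (rk h - 1)) => // [k /hsP[_ rkk]|[y k] /= kr].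
    split=> // y; split=> /=; first by left; rewrite rkk; lia.
    by move=> [_ kh]; move: rkk; rewrite kh; lia.
  split; first by left; lia.
  by move=> [_ kh]; move: kr; rewrite kh; lia.
- rewrite inE => /orP[/eqP->|]; first exact: edge_side.
  by rewrite -map_comp => /mapP[k /hsP[? _] ->].
rewrite big_cons; apply: ler_pM (prod_full_row _ _).
- exact: (rho_ge0 N_gt0).
- by apply: prodr_ge0 => c _; exact: (rho_ge0 N_gt0).
- exact: (rho_le_worst hN).
Qed.

(** Both neighbors on the row come first; each sees the half row that points
    away from v. *)
Lemma full_row_step : p <= (1 - worst N full_row) *
  (worst N half_row * (worst N half_row * worst N full_row ^+ m)).
Proof.
apply: (worst_step hN p_gt0 N_gt0 v0) => [[x h] /=|[x h]].
  by rewrite ltxx eqxx; case=> // -[].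
have [hs [<- uhs hsP]] := below x h.
exists (half_row ((x - 1, h), true) :: half_row ((x - (-1), h), false)
  :: [seq full_row (x, k) | k <- hs]).
split=> [/=|w /=|].
- split.
  + by right; split => //; apply/eqP; lia.
  + move=> [y k] /= [kr|[-> yx]]; [by left|right; split=> //].
    by apply/eqP; lia.
  + by rewrite ltxx subrr mulr0 ltxx; case=> // -[].
  split.
  + split; first by right; split => //; apply/eqP; lia.
    by case; lia.
  + move=> [y k] /= [kr|[-> yx']]; split.
    * by left.
    * by case=> _ kh; move: kr; rewrite kh ltxx.
    * by right; split=> //; apply/eqP; lia.
    * by case=> yx; move: yx'; rewrite yx; lia.
  + by rewrite ltxx subrr mulr0 ltxx; case=> // -[].
  apply: (@nested_full_row _ _ (rk h - 1)) => // [k /hsP[_ rkk]|[y k] /= kr].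
    split=> // y; split; last by move=> [_ kh]; move: rkk; rewrite kh; lia.
    split; last by move=> [_ kh]; move: rkk; rewrite kh; lia.
    by left; rewrite /= rkk; lia.
  split; last by move=> [_ kh]; move: kr; rewrite kh; lia.
  split; last by move=> [_ kh]; move: kr; rewrite kh; lia.
  by left; rewrite /=; lia.
- rewrite !inE => /or3P[/eqP->|/eqP->|]; first exact: (edge_side true).
    exact: (edge_side false).
  by rewrite -map_comp => /mapP[k /hsP[? _] ->].
rewrite !big_cons; apply: ler_pM.
- exact: (rho_ge0 N_gt0).
- rewrite mulr_ge0//; first exact: (rho_ge0 N_gt0).
  by apply: prodr_ge0 => c _; exact: (rho_ge0 N_gt0).
- exact: (rho_le_worst hN).
apply: ler_pM (prod_full_row _ _).
- exact: (rho_ge0 N_gt0).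
- by apply: prodr_ge0 => c _; exact: (rho_ge0 N_gt0).
- exact: (rho_le_worst hN).
Qed.

End Cylinder.

(** * The plane *)

Section Plane.
Variables (R : realType) (e : rel (int * int)) (p : R).
Variables (N : seq (int * int) -> R).
Hypotheses (es : symmetric e) (hN : hard_core e p N) (p_gt0 : 0 < p).
Hypothesis N_gt0 : forall s, 0 < N s.
Hypothesis eP : forall x y, e (x, y) (x - 1, y).
Hypothesis eD : forall x y, e (x, y) (x, y - 1).

Local Notation V := (int * int)%type.
Local Notation half := (@half_row int id).
Local Notation full := (@full_row int id).

(** The vertex above v contributes a factor 1 - p in [half_row_up_step], which
    makes this region strictly better than the half row. *)
Definition half_row_up (i : V * bool) : V * set V :=
  (i.1, ((half i).2 `|` [set (i.1.1, i.1.2 + 1)])%classic).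

(** The row above is kept only strictly to the side of v; the neighbor of v on
    that side then has a vertex above it, as in [half_row_up]. *)
Definition half_row_shelf (i : V * bool) : V * set V :=
  (i.1, ((half i).2 `|` [set u : V | u.2 = i.1.2 + 1 /\
    sg i.2 * (u.1 - i.1.1) <= -1])%classic).

(** This is what the vertex below the apex of a half row sees once the neighbor
    of that apex is deleted: its own full row, and the part of the row above
    that starts two steps to the side. *)
Definition full_row_shelf (i : V * bool) : V * set V :=
  (i.1, ((full i.1).2 `|` [set u : V | u.2 = i.1.2 + 1 /\
    sg i.2 * (u.1 - i.1.1) <= -2])%classic).

Local Notation a := (worst N half).
Local Notation b := (worst N full).
Local Notation b' := (worst N full_row_shelf).
Local Notation c := (worst N half_row_shelf).
Local Notation f := (worst N half_row_up).

Let edge_side_plane s x h : e (x, h) (x - sg s, h).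
Proof. exact: (edge_side es eP). Qed.

Lemma half_row_with_shelf_step : p <= (1 - a) * (a * b').
Proof.
apply: (worst_step hN p_gt0 N_gt0 ((0, 0), true)) => [[[x y] s] /=|[[x y] s]].
  by rewrite ltxx subrr mulr0 ltxx; case=> // -[].
exists [:: half ((x - sg s, y), s); full_row_shelf ((x, y - 1), s)].
split=> [/=|w /=|].
- split.
  + by right; split => //; case: s => /=; lia.
  + by move=> [z k] /=; case: s => /=; lia.
  + by case: s => /=; lia.
  split=> //.
  + split; first by left; lia.
    by case; lia.
  + move=> [z k] /= H; split; last by case; case: s H => /=; lia.
    by case: s H => /=; lia.
  + by case: s => /=; lia.
- by rewrite !inE => /orP[/eqP->|/eqP->].
rewrite !big_cons big_nil mulr1.
by apply: ler_pM; rewrite ?(rho_ge0 N_gt0) ?(rho_le_worst hN).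
Qed.

Lemma full_row_shelf_step : p <= (1 - b') * (c * (a * b)).
Proof.
apply: (worst_step hN p_gt0 N_gt0 ((0, 0), true)) => [[[x y] s] /=|[[x y] s]].
  by case: s => /=; lia.
exists [:: half_row_shelf ((x - sg s, y), s); half ((x + sg s, y), ~~ s);
  full (x, y - 1)].
split=> [/=|w /=|].
- split.
  + by left; right; split => //; case: s => /=; lia.
  + by move=> [z k] /=; case: s => /=; lia.
  + by case: s => /=; lia.
  split=> //.
  + split; first by left; right; case: s => /=; lia.
    by case; case: s => /=; lia.
  + move=> [z k] /= H; split; last by case; case: s H => /=; lia.
    by case: s H => /=; lia.
  + by case: s => /=; lia.
  split=> //; last by lia.
  + split; last by case; lia.
    split; last by case; lia.
    by left; left; lia.
  move=> [z k] /= H; split; last by case; lia.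
  by split; [lia | case; lia].
- rewrite !inE => /or3P[/eqP->|/eqP->|/eqP->] //.
  by have := edge_side_plane (~~ s) x y; case: s => /=; rewrite ?opprK.
rewrite !big_cons big_nil mulr1.
by do 2?[apply: ler_pM; rewrite ?mulr_ge0 ?(rho_ge0 N_gt0) ?(rho_le_worst hN)].
Qed.

Lemma half_row_shelf_step : p <= (1 - c) * (f * b).
Proof.
apply: (worst_step hN p_gt0 N_gt0 ((0, 0), true)) => [[[x y] s] /=|[[x y] s]].
  by case: s => /=; lia.
exists [:: half_row_up ((x - sg s, y), s); full (x, y - 1)].
split=> [/=|w /=|].
- split.
  + by left; right; split => //; case: s => /=; lia.
  + move=> [z k] /= [|[-> ->]]; case: s => /=; lia.
  + by move=> [|[]]; case: s => /=; lia.
  split=> //; last by lia.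
  + split; last by case; lia.
    by left; left; lia.
  move=> [z k] /= H; split; last by case; lia.
  by left; left; lia.
- by rewrite !inE => /orP[/eqP->|/eqP->].
rewrite !big_cons big_nil mulr1.
by apply: ler_pM; rewrite ?(rho_ge0 N_gt0) ?(rho_le_worst hN).
Qed.

Lemma half_row_up_step : p <= (1 - f) * ((1 - p) * (a * b)).
Proof.
apply: (worst_step hN p_gt0 N_gt0 ((0, 0), true)) => [[[x y] s] /=|[[x y] s]].
  by move=> [|[]]; case: s => /=; lia.
exists [:: ((x, y + 1), set0); half ((x - sg s, y), s); full (x, y - 1)].
split=> [/=|w /=|].
- split=> //.
  + by right.
  split=> //.
  + split; last by case; lia.
    by left; right; case: s => /=; lia.
  + move=> [z k] /= H; split; last by case; case: s H => /=; lia.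
    by left; case: s H => /=; lia.
  + by case: s => /=; lia.
  split=> //; last by lia.
  + split; last by case; lia.
    split; last by case; lia.
    by left; left; lia.
  move=> [z k] /= H; split; last by case; case: s H => /=; lia.
  split; last by case; lia.
  by left; left; lia.
- rewrite !inE => /or3P[/eqP->|/eqP->|/eqP->] //.
  by rewrite es -{2}(addrK 1 y).
rewrite !big_cons big_nil mulr1.
apply: ler_pM; rewrite ?mulr_ge0 ?(rho_ge0 N_gt0)//; last first.
  by apply: ler_pM; rewrite ?(rho_ge0 N_gt0) ?(rho_le_worst hN).
apply: le_trans (rho_le_ratio N_gt0 (s := [::]) _) _ => //.
by rewrite (ratioE hN N_gt0)//= divff ?mulr1// (hc_nil hN) oner_eq0.
Qed.

(** The steps for [half] and [full] force a = 3/4, b = 2/3 and p = 1/8. The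
    first step holds also with b' in place of b, and b' <= b, so it forces
    b' = 2/3 too; but following the chain f, c, b' of improved regions gives
    f <= 5/7, c <= 59/80 and b' <= 39/59 < 2/3. *)
Lemma plane_density : p < 1 / 8.
Proof.
rewrite ltNge; apply/negP => p8.
have i0 : V * bool := ((0, 0), true).
have s1 := half_row_with_shelf_step.
have s2 : p <= (1 - b) * (a * (a * b)).
  have := @full_row_step _ _ e p N id 1 (0, 0) es hN p_gt0 N_gt0 eP; apply.
  by move=> x y; exists [:: y - 1]; split => // k; rewrite inE => /eqP->.
have s3 := full_row_shelf_step.
have s4 := half_row_shelf_step.
have s5 := half_row_up_step.
have b'b : b' <= b.
  apply: ge_sup; first by exists (rho N (full_row_shelf i0)), i0.
  move=> _ [i _ <-]; apply: le_trans (rho_le_worst hN N_gt0 full i.1).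
  have sub : ((full i.1).2 `<=` (full_row_shelf i).2)%classic by move=> u; left.
  exact: (@rho_anti _ _ _ N_gt0 i.1 _ _ sub).
have a0 : 0 <= a := worst_ge0 hN N_gt0 half i0.
have a1 : a <= 1 := worst_le1 hN N_gt0 half i0.
have b0 : 0 <= b := worst_ge0 hN N_gt0 full i0.1.
have c1 : c <= 1 := worst_le1 hN N_gt0 half_row_shelf i0.
have f1 : f <= 1 := worst_le1 hN N_gt0 half_row_up i0.
have b'0 : 0 <= b' := worst_ge0 hN N_gt0 full_row_shelf i0.
have c0 : 0 <= c := worst_ge0 hN N_gt0 half_row_shelf i0.
have f0 : 0 <= f := worst_ge0 hN N_gt0 half_row_up i0.
clear hN; move: s1 s2 s3 s4 s5 b'b a0 a1 b0 c1 f1 b'0 c0 f0.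
move: a b b' c f => A B B' C F; clear -p8.
move=> s1 s2 s3 s4 s5 B'B A0 A1 B0 C1 F1 B'0 C0 F0.
have s1' : p <= (1 - A) * (A * B).
  by apply: le_trans s1 _; rewrite ler_wpM2l ?subr_ge0// ler_wpM2l.
(* With u = 1 - A and k = A B, the two steps are p <= k u and
   p <= k (1 - u - k); their sum is 2 p <= k (1 - k). *)
have k2 : (A * B - 1 / 2) ^+ 2 <= 0 by nra.
have k : A * B = 1 / 2.
  by apply/eqP; rewrite -subr_eq0 -sqrf_eq0 eq_le k2 sqr_ge0.
have A34 : A = 3 / 4.
  move: s1' s2.
  rewrite (_ : (1 - B) * (A * (A * B)) = (A - A * B) * (A * B)); last by ring.
  by rewrite k; lra.
have B23 : B = 2 / 3 by move: k; rewrite A34; lra.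
have F57 : F <= 5 / 7 by move: s5; rewrite k; nra.
subst A B.
have C59 : C <= 59 / 80 by nra.
have B'39 : B' <= 39 / 59 by nra.
by nra.
Qed.
End Plane.

(** * The three-dimensional lattice *)

Section Space.
Variables (R : realType) (e : rel (int * (int * int))) (p : R).
Variables (N : seq (int * (int * int)) -> R).
Hypotheses (es : symmetric e) (hN : hard_core e p N) (p_gt0 : 0 < p).
Hypothesis N_gt0 : forall s, 0 < N s.
Hypothesis e1 : forall x h, e (x, h) (x - 1, h).
Hypothesis e2 : forall x y z, e (x, (y, z)) (x, (y - 1, z)).
Hypothesis e3 : forall x y z, e (x, (y, z)) (x, (y, z - 1)).

(** Let a and b be the suprema for half rows and for full rows, and k = a b.
    The two steps become a (k^2 + p) <= k^2 and
    k^3 <= a (k^2 - p). Eliminating a gives k^3 - k^2 + p k + p <= 0, which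
    for p >= 1/11 contradicts 11 k^3 - 11 k^2 + k + 1 > 0. *)
Lemma space_density : p < 1 / 11.
Proof.
rewrite ltNge; apply/negP => p11.
pose rk (h : int * int) := h.1 + h.2.
have below x h : exists hs, [/\ size hs = 2%N, uniq hs
    & forall k, k \in hs -> e (x, h) (x, k) /\ rk k = rk h - 1].
  case: h => y z; exists [:: (y - 1, z); (y, z - 1)]; split => //=.
    by rewrite inE xpair_eqE andbT negb_and; apply/orP; left; lia.
  by move=> k; rewrite !inE => /orP[/eqP->|/eqP->]; split=> //; rewrite /rk /=; lia.
have v0 : int * (int * int) := (0, (0, 0)).
have s1 := half_row_step v0 es hN p_gt0 N_gt0 e1 below.
have s2 := full_row_step v0 es hN p_gt0 N_gt0 e1 below.
have a0 := worst_ge0 hN N_gt0 (half_row rk) (v0, true).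
have b0 := worst_ge0 hN N_gt0 (full_row rk) v0.
move: s1 s2 a0 b0; move: (worst N (half_row rk)) (worst N (full_row rk)) => A B.
clear -p11 => s1 s2 A0 B0.
have [k kE] : {k | k = A * B} by exists (A * B).
have k0 : 0 <= k by rewrite kE mulr_ge0.
have t1 : A * (k ^+ 2 + p) <= k ^+ 2.
  have : A * p <= A * ((1 - A) * (A * B ^+ 2)) by rewrite ler_wpM2l.
  rewrite (_ : A * ((1 - A) * _) = k ^+ 2 - A * k ^+ 2); last by rewrite kE; ring.
  by rewrite mulrDr; lra.
have t2 : k ^+ 3 <= A * (k ^+ 2 - p).
  have : A * p <= A * ((1 - B) * (A * (A * B ^+ 2))) by rewrite ler_wpM2l.
  rewrite (_ : A * ((1 - B) * _) = A * k ^+ 2 - k ^+ 3); last by rewrite kE; ring.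
  by rewrite mulrBr; lra.
have kp : p <= k ^+ 2.
  apply: le_trans s2 _.
  rewrite (_ : (1 - B) * _ = (1 - B) * k ^+ 2); last by rewrite kE; ring.
  by rewrite ler_piMl ?sqr_ge0// gerBl.
have kp1 : 0 < k ^+ 2 by lra.
have t3 : k ^+ 3 * (k ^+ 2 + p) <= k ^+ 2 * (k ^+ 2 - p).
  apply: (@le_trans _ _ (A * (k ^+ 2 - p) * (k ^+ 2 + p))).
    by rewrite ler_wpM2r// addr_ge0 ?sqr_ge0//; lra.
  rewrite [leLHS]mulrAC.
  by rewrite ler_wpM2r// subr_ge0.
have : k * (k ^+ 2 + p) <= k ^+ 2 - p.
  rewrite -(ler_pM2l kp1); apply: le_trans t3.
  by rewrite mulrA -exprSr.
(* 21/34 approximates the minimizer of 11 k^3 - 11 k^2 + k + 1 on [0, 1], and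
   4/17 is chosen to match the coefficient of k^2. *)
have : 0 <= (k + 4 / 17) * (k - 21 / 34) ^+ 2.
  by rewrite mulr_ge0 ?sqr_ge0//; lra.
by nra.
Qed.
End Space.

(** * Density bounds on integer lattices *)

Lemma dist1_sub_delta d (v : 'rV[int]_d) i :
  dist1 v (v - delta_mx ord0 i) = 1.
Proof.
rewrite /dist1 (bigD1 i)//= big1 ?addr0 => [|j ji].
  by rewrite !mxE !eqxx opprB addrC subrK normr1.
by rewrite !mxE eqxx (negbTE ji) subr0 subrr normr0.
Qed.

Lemma lattice_density (R : realType) (d : nat) (p : R)
    (N : seq 'rV[int]_d -> R) : (0 < d)%N -> 0 < p ->
  hard_core (@edge (Zlattice d)) p N ->
  p <= d%:R ^+ d / (d + 1)%:R ^+ (d + 1).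
Proof.
move=> d0 p0 hN.
pose rk (v : 'rV[int]_d) : int := \sum_i v ord0 i.
apply: (ranked_density (rk := rk) 0 (@Zlattice_sym d) hN p0 d0) => v.
exists [seq v - delta_mx ord0 i | i <- enum 'I_d]; split.
- by rewrite size_map size_enum_ord.
- rewrite map_inj_uniq ?enum_uniq// => i j /addrI /oppr_inj /matrixP.
  move=> /(_ ord0 i); rewrite !mxE !eqxx /=.
  by case: eqP.
move=> w /mapP[i _ ->]; split; first by rewrite /= dist1_sub_delta.
rewrite /rk [in LHS](bigD1 i)//= [in RHS](bigD1 i)//= !mxE !eqxx addrAC.
congr (_ + _ - _); apply: eq_bigr => j /negbTE ji.
by rewrite !mxE ji andbF subr0.
Qed.

Definition plane_embed (u : int * int) : 'rV[int]_2 :=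
  \row_j (if j == ord0 then u.1 else u.2).

Definition space_embed (u : int * (int * int)) : 'rV[int]_3 :=
  \row_j (if j == ord0 then u.1 else if j == 1%R then u.2.1 else u.2.2).

Lemma plane_lattice_density (R : realType) (p : R) (N : seq 'rV[int]_2 -> R) :
  0 < p -> hard_core (@edge (Zlattice 2)) p N -> p < 1 / 8.
Proof.
move=> p0 hN.
pose e (u v : int * int) := @edge (Zlattice 2) (plane_embed u) (plane_embed v).
have distE u v : dist1 (plane_embed u) (plane_embed v) =
    `|u.1 - v.1| + `|u.2 - v.2|.
  by rewrite /dist1 !big_ord_recl big_ord0 !mxE/= addr0.
have es : symmetric e by move=> u v; exact: Zlattice_sym.
have inj : injective plane_embed.
  move=> [x y] [x' y'] /matrixP E.
  have := E ord0 ord0; have := E ord0 1.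
  by rewrite !mxE /= => -> ->.
have hN' := hard_core_pullback inj (fun u v => erefl (e u v)) hN.
have e1 x y : e (x, y) (x - 1, y) by rewrite /e /= distE /=; lia.
have e2 x y : e (x, y) (x, y - 1) by rewrite /e /= distE /=; lia.
apply: (plane_density es hN') => //.
apply: (hard_core_gt0 (rk := fst) es hN' p0) => -[x y].
by exists (x - 1, y) => //=; lia.
Qed.

Lemma space_lattice_density (R : realType) (p : R) (N : seq 'rV[int]_3 -> R) :
  0 < p -> hard_core (@edge (Zlattice 3)) p N -> p < 1 / 11.
Proof.
move=> p0 hN.
pose e (u v : int * (int * int)) :=
  @edge (Zlattice 3) (space_embed u) (space_embed v).
have distE u v : dist1 (space_embed u) (space_embed v) =
    `|u.1 - v.1| + (`|u.2.1 - v.2.1| + `|u.2.2 - v.2.2|).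
  by rewrite /dist1 !big_ord_recl big_ord0 !mxE/= addr0.
have es : symmetric e by move=> u v; exact: Zlattice_sym.
have inj : injective space_embed.
  move=> [x [y z]] [x' [y' z']] /matrixP E.
  have := E ord0 ord0; have := E ord0 1; have := E ord0 2.
  by rewrite !mxE /= => -> -> ->.
have hN' := hard_core_pullback inj (fun u v => erefl (e u v)) hN.
have e1 x h : e (x, h) (x - 1, h) by rewrite /e /= distE /=; lia.
have e2 x y z : e (x, (y, z)) (x, (y - 1, z)) by rewrite /e /= distE /=; lia.
have e3 x y z : e (x, (y, z)) (x, (y, z - 1)) by rewrite /e /= distE /=; lia.
apply: (space_density es hN') => //.
apply: (hard_core_gt0 (rk := fst) es hN' p0) => -[x y].
by exists (x - 1, y) => //=; lia.
Qed.

(** * The color classes of a 1-dependent coloring *)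

Section ColorClass.
Context {disp : measure_display} {Om : measurableType disp} {R : realType}.
Variables (P : probability Om R) (G : graph) (X : G -> {RV P >-> nat}).
Local Open Scope classical_set_scope.

Definition color_at (a : nat) (v : G) : set Om := X v @^-1` [set a].

Definition no_color (a : nat) (s : seq G) : set Om :=
  [set w | forall u, u \in s -> X u w <> a].

Lemma no_color_nil a : no_color a [::] = setT.
Proof. by apply/seteqP; split. Qed.

Lemma no_color_cons a v s : no_color a (v :: s) = no_color a s `\` color_at a v.
Proof.
apply/seteqP; split => w /=.
  move=> H; split; last by apply: H; rewrite mem_head.
  by move=> u us; apply: H; rewrite inE us orbT.
by move=> [H Hv] u; rewrite inE => /orP[/eqP->|/H].
Qed.

Lemma sigma_restr_color (A : set G) a v : A v -> sigma_restr X A (color_at a v).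
Proof.
move=> Av; apply: sub_gen_smallest; exists v => //.
by exists [set a] => //; rewrite setTI.
Qed.

Lemma sigma_restr_no_color (A : set G) a s : (forall u, u \in s -> A u) ->
  sigma_restr X A (no_color a s).
Proof.
pose T := g_sigma_algebraType
  (\bigcup_(v in A) preimage_set_system [set: Om] (X v) measurable).
elim: s => [|v s IH] sA.
  by rewrite no_color_nil; apply: (@measurableT _ T).
rewrite no_color_cons; apply: (@measurableD _ T).
  by apply: IH => u us; apply: sA; rewrite inE us orbT.
by apply: sigma_restr_color; apply: sA; rewrite mem_head.
Qed.

Lemma measurable_color a v : measurable (color_at a v).
Proof.
by rewrite /color_at -[X in measurable X]setTI; exact: measurable_funPT.
Qed.

Lemma measurable_no_color a s : measurable (no_color a s).
Proof.
elim: s => [|v s IH]; first by rewrite no_color_nil.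
by rewrite no_color_cons; apply: measurableD => //; exact: measurable_color.
Qed.

Lemma negligible_clash v (s : seq G) :
  (forall u v : G, edge u v -> \forall w \ae P, X u w != X v w) ->
  P.-negligible [set w | exists2 u, u \in s & edge v u /\ X v w = X u w].
Proof.
move=> col; elim: s => [|u s IH].
  by apply: (negligibleS _ (negligible_set0 P)) => w [].
have [vu|vu] := boolP (edge v u).
  apply: (negligibleS _ (negligibleU (col _ _ vu) IH)) => w [x + [vx Xvx]].
  rewrite inE => /orP[/eqP xu|xs]; last by right; exists x.
  by left => /=; rewrite -xu Xvx eqxx.
apply: (negligibleS _ IH) => w [x + [vx Xvx]].
rewrite inE => /orP[/eqP xu|xs]; last by exists x.
by move: vu; rewrite -xu vx.
Qed.

(** On the event that v has the color a, avoiding a on s is almost surely the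
    same as avoiding it on the vertices of s that are not neighbors of v, and
    1-dependence makes the latter independent of the color of v. *)
Lemma hard_core_color (q a : nat) (p : R) : is_coloring X q ->
  k_dependent X 1 -> (forall v, P (color_at a v) = p%:E) ->
  hard_core (@edge G) p (fun s => fine (P (no_color a s))).
Proof.
move=> [_ col] dep Pp.
have fin A : measurable A -> P A \is a fin_num by exact: fin_num_measure.
have mN := measurable_no_color a; have mC := measurable_color a.
split.
- by rewrite no_color_nil probability_setT.
- move=> s t st; apply: fine_le; rewrite ?fin//; apply: le_measure.
  + by rewrite inE.
  + by rewrite inE.
  + by move=> w H u /st /H.
- by move=> s; rewrite fine_ge0.
move=> v s vs; pose s' := [seq u <- s | ~~ edge v u].
have indep : P (no_color a s' `&` color_at a v) =
    (P (no_color a s') * P (color_at a v))%E.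
  apply: (dep [set` s'] [set v]).
  - move=> u w [|x [|//]] us /= -> [/=].
      by move=> _ uv; move: us vs; rewrite /= uv mem_filter => /andP[_ ->].
    rewrite andbT => ux xv; move: us ux; rewrite /= xv mem_filter edge_sym.
    by case/andP => /negbTE ->.
  - exact: sigma_restr_no_color.
  - exact: sigma_restr_color.
have null : P ((no_color a s' `&` color_at a v) `\` no_color a s) = 0%E.
  apply: measure_negligible.
    by apply: measurableD => //; apply: measurableI.
  apply: (negligibleS _ (negligible_clash v s col)) => w [[Hs' Xv] Hs].
  apply: contrapT => H; apply: Hs => u us Xu; apply: H; exists u => //.
  split; last by rewrite Xu.
  apply: contrapT => /negP vu; apply: (Hs' u) => //.
  by rewrite mem_filter vu.
have main : (P (no_color a s) =
    P (no_color a (v :: s)) + P (no_color a s') * p%:E)%E.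
  rewrite (measureDI P (mN s) (mC v)) no_color_cons; congr (_ + _)%E.
  rewrite -(Pp v) -indep.
  rewrite (measureDI P (measurableI _ _ (mN s') (mC v)) (mN s)).
  rewrite [X in (X + _)%E](_ : _ = 0%E) ?add0e; last exact: null.
  congr (P _); apply/seteqP; split => w /=.
    move=> [Hs Hv]; split=> //; split=> // u.
    by rewrite mem_filter => /andP[_ /Hs].
  by move=> [[_ ?] ?].
rewrite main fineD ?fin//; last by rewrite fin_numM ?fin.
by rewrite fineM ?fin//= mulrC addrK.
Qed.

Lemma exists_frequent_color (q : nat) (v : G) : is_coloring X q ->
  exists2 a, (a < q)%N & (q%:R^-1 <= fine (P (color_at a.+1 v)))%R.
Proof.
move=> [rng _]; apply: contrapT => none.
have small a : (a < q)%N -> (fine (P (color_at a.+1 v)) < q%:R^-1)%R.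
  by move=> aq; rewrite ltNge; apply/negP => H; apply: none; exists a.
have : P (\big[setU/set0]_(a < q) color_at a.+1 v) = 1%E.
  rewrite -(probability_setT P); congr (P _); apply/seteqP; split => // w _.
  have := rng v w; case E : (X v w) => [//|a] /andP[_ aq].
  by rewrite -(bigcup_mkord _ (fun i => color_at i.+1 v)); exists a.
rewrite (@measure_bigsetU _ _ _ P (fun i => color_at i.+1 v)); last first.
- move=> i j _ _ [w [/= Xi Xj]].
  by case: (etrans (esym Xi) Xj).
- by move=> a; exact: measurable_color.
rewrite (eq_bigr (fun a : 'I_q => (fine (P (color_at a.+1 v)))%:E)); last first.
  by move=> a _; rewrite fineK// fin_num_measure//; exact: measurable_color.
rewrite sumEFin => -[sum1].
case: q rng none small sum1 => [|q] rng none small.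
  by rewrite big_ord0 => /eqP; rewrite eq_sym oner_eq0.
apply/eqP; rewrite lt_eqF//.
apply: (@lt_le_trans _ _ (\sum_(a < q.+1) q.+1%:R^-1)%R); last first.
  by rewrite sumr_const card_ord -[leLHS]mulr_natr mulVf// pnatr_eq0.
by apply: ltr_sum => [|a _]; [apply/hasP; exists ord0; rewrite ?mem_index_enum|exact: small].
Qed.

End ColorClass.

Section Density.
Context {disp : measure_display} {Om : measurableType disp} {R : realType}.
Variables (P : probability Om R) (G : graph) (X : G -> {RV P >-> nat}).

Lemma frequent_hard_core (q : nat) (v : G) :
  is_coloring X q -> k_dependent X 1 -> identically_distributed X ->
  (0 < q)%N /\ exists p N, hard_core (@edge G) (p : R) N /\ q%:R^-1 <= p.
Proof.
move=> col dep idd; have [a aq pa] := exists_frequent_color v col.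
split; first exact: leq_ltn_trans aq.
exists (fine (P (color_at X a.+1 v))).
exists (fun s => fine (P (no_color X a.+1 s))); split=> //.
apply: (hard_core_color col dep) => u.
rewrite fineK ?fin_num_measure//; last exact: measurable_color.
exact: (idd u v [set a.+1]%classic).
Qed.

End Density.

(** * The bounds on the number of colors *)

Lemma inv_density_le (R : realFieldType) (q : nat) (p x y : R) :
  (0 < q)%N -> q%:R^-1 <= p -> 0 < x -> 0 < y -> p <= x / y -> y / x <= q%:R.
Proof.
move=> q0 qp x0 y0 pxy; rewrite -[leRHS]invrK -[leLHS]invrK lef_pV2.
- by rewrite invf_div (le_trans qp).
- by rewrite posrE invr_gt0 divr_gt0.
- by rewrite posrE invr_gt0 ltr0n.
Qed.

Lemma color_count_gt (R : realFieldType) (q n : nat) (p : R) :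
  (0 < q)%N -> (0 < n)%N -> q%:R^-1 <= p -> p < 1 / n%:R -> (n < q)%N.
Proof.
move=> q0 n0 qp pn; rewrite -(ltr_nat R) -ltf_pV2 ?posrE ?ltr0n//.
by rewrite -[ltRHS]mul1r; exact: le_lt_trans pn.
Qed.

Theorem proposition7 (R : realType) (G : graph) (q : nat) :
  (exists (disp : measure_display) (Om : measurableType disp)
          (P : probability Om R) (X : G -> {RV P >-> nat}),
     [/\ is_coloring X q, k_dependent X 1 & identically_distributed X]) ->
  (forall d : nat, (1 <= d)%N -> graph_isomorphic G (Zlattice d) ->
     [/\ (q%:R : R) >= (d + 1)%:R ^+ (d + 1) / d%:R ^+ d,
         d = 2%N -> (9 <= q)%N
       & d = 3%N -> (12 <= q)%N]) /\
  (forall D : nat, (2 <= D)%N -> infinite_regular_tree D G ->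
     (q%:R : R) >= D%:R ^+ D / (D - 1)%:R ^+ (D - 1)).
Proof.
move=> [disp [Om [P [X [col dep idd]]]]].
split=> [d d0 [f [g fK gK] fE]|D D2 tree]; last first.
  have [inf _ _ _] := tree.
  have [v _] := infinite_set_nonempty inf.
  have [q0 [p [N [hN qp]]]] := frequent_hard_core v col dep idd.
  have p0 : 0 < p by rewrite (lt_le_trans _ qp)// invr_gt0 ltr0n.
  apply: (inv_density_le q0 qp) (tree_density D2 tree p0 hN).
    by rewrite exprn_gt0// ltr0n; lia.
  by rewrite exprn_gt0// ltr0n; lia.
have [q0 [p [N [hN qp]]]] := frequent_hard_core (g 0) col dep idd.
have p0 : 0 < p by rewrite (lt_le_trans _ qp)// invr_gt0 ltr0n.
have hZ : hard_core (@edge (Zlattice d)) p (N \o map g).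
  by apply: hard_core_pullback hN => [|u v]; [exact: can_inj gK|rewrite -fE !gK].
split.
- apply: (inv_density_le q0 qp) (lattice_density d0 p0 hZ).
    by rewrite exprn_gt0// ltr0n.
  by rewrite exprn_gt0// ltr0n addn1.
- move=> d2; move: (N \o map g) hZ; rewrite d2 => N' hZ.
  exact: color_count_gt q0 _ qp (plane_lattice_density p0 hZ).
- move=> d3; move: (N \o map g) hZ; rewrite d3 => N' hZ.
  exact: color_count_gt q0 _ qp (space_lattice_density p0 hZ).
Qed.
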